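(* Let $G_1,\dots,G_{42}$ be the complete list of $4$-vertex oriented graphs up to isomorphism, $c_i=t(G_i)+i(G_i)$, and let $\mathcal F=\mathcal F_\emptyset\cup\mathcal F_{\bar E}\cup\mathcal F_E$ (20 flags in total, in a fixed order). Then there exists a $20\times20$ positive semidefinite matrix $Q$ such that $c_i\ge\langle Q,A_{G_i}\rangle+\frac19$ for every $1\le i\le 42$ (a $\frac19$-certificate for the SDP: minimize $\sum_i p_ic_i$ subject to $p_i\ge0$, $\sum_ip_i=1$, $\sum_i p_iA_{G_i}\succeq0$).
   Context: An oriented graph is a directed graph with no loops and no multiple (parallel or anti-parallel) edges; $t(G)$ (resp. $i(G)$) is the probability that a uniformly random $3$-set of vertices of $G$ induces a transitive triangle (resp. an independent set). A type is an oriented graph with vertices labeled $1,\dots,|\sigma|$; a flag over type $\sigma$ is an oriented graph with an induced embedding of $\sigma$; flags are isomorphic if there is an isomorphism preserving the labeled type vertices. The types used are: the empty type $\emptyset$; the non-edge type $\bar E$ (two labeled vertices, no edge); the edge type $E$ (two labeled vertices with the edge directed from vertex $1$ to vertex $2$). $\mathcal F_\emptyset$ is the set of all (isomorphism classes of) flags over $\emptyset$ with $2$ vertices (2 flags), $\mathcal F_{\bar E}$ the set of all $3$-vertex flags over $\bar E$ (9 flags), and $\mathcal F_E$ the set of all $3$-vertex flags over $E$ (9 flags). A $\sigma$-rooting of $G$ is a flag over $\sigma$ with underlying graph $G$. For flags $F_1,F_2\in\mathcal F$ and an oriented graph $G$, $p(F_1,F_2;G)$ is defined by choosing a uniformly random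 $\sigma$-rooting of $G$ with type image $S$ and uniformly random disjoint $L_1,L_2\subseteq V(G)\setminus S$ with $|L_j|=|F_j|-|\sigma|$; it is the probability that the flag induced on $S\cup L_j$ is isomorphic to $F_j$ for $j=1,2$ (and it is $0$ if $F_1,F_2$ have different types or the process is ill-defined). $A_G$ is the $20\times20$ matrix with entries $p(F_1,F_2;G)$, and $\langle A,B\rangle=\sum_{i,j}a_{ij}b_{ij}$. *)

(* Defs.v *)
From mathcomp Require Import all_boot all_order all_algebra.
From mathcomp Require Import reals.

Set Implicit Arguments.
Unset Strict Implicit.
Unset Printing Implicit Defensive.

Import Order.TTheory GRing.Theory Num.Theory.
Local Open Scope ring_scope.

(* Oriented graphs with vertex set 'I_n; [edge G x y] is the edge x -> y. *)

Definition oriented (n : nat) (e : {ffun 'I_n * 'I_n -> bool}) : bool :=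
  [forall x, ~~ e (x, x)] && [forall x, forall y, e (x, y) ==> ~~ e (y, x)].

Definition ograph (n : nat) := {e : {ffun 'I_n * 'I_n -> bool} | oriented e}.

Definition edge (n : nat) (G : ograph n) : rel 'I_n := fun x y => val G (x, y).

Definition embedding (k n : nat) (H : ograph k) (G : ograph n)
    (f : {ffun 'I_k -> 'I_n}) : bool :=
  injectiveb f && [forall x, forall y, edge G (f x) (f y) == edge H x y].

(* An injective self-map of 'I_n is a bijection. *)
Definition ograph_iso (n : nat) (G H : ograph n) : bool :=
  [exists f : {ffun 'I_n -> 'I_n}, embedding G H f].

Section UniformChoice.
Variables (R : realType) (T : finType).

(* Uniform choice from an empty set is "ill-defined": as x / 0 = 0, both of
   these are then 0. *)
Definition mean (A : {set T}) (f : T -> R) : R :=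
  (\sum_(x in A) f x) / #|A|%:R.

Definition prob (A : {set T}) (P : pred T) : R :=
  #|[set x in A | P x]|%:R / #|A|%:R.

End UniformChoice.

Definition three_sets (n : nat) : {set {set 'I_n}} :=
  [set A : {set 'I_n} | #|A| == 3%N].

Definition transitive_triangle (n : nat) (G : ograph n) (A : {set 'I_n}) :=
  [exists x, exists y, exists z,
    [&& A == [set x; y; z], edge G x y, edge G y z & edge G x z]].

Definition independent (n : nat) (G : ograph n) (A : {set 'I_n}) :=
  [forall x in A, forall y in A, ~~ edge G x y].

Definition t_density (R : realType) (n : nat) (G : ograph n) : R :=
  prob R (three_sets n) (transitive_triangle G).

Definition i_density (R : realType) (n : nat) (G : ograph n) : R :=
  prob R (three_sets n) (independent G).

(* A type is a labeled oriented graph: equality of types is equality of labeled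
   graphs.  The labels 1, ..., k are the elements 0, ..., k - 1 of 'I_k. *)

Definition ftype := {k : nat & ograph k}.

Lemma empty_oriented (n : nat) :
  oriented [ffun _ : 'I_n * 'I_n => false].
Proof.
by apply/andP; split; apply/forallP=> x;
  [rewrite ffunE | apply/forallP=> y; rewrite !ffunE].
Qed.

Lemma edge_oriented :
  oriented [ffun xy : 'I_2 * 'I_2 => (xy.1 == 0%N :> nat) && (xy.2 == 1%N :> nat)].
Proof.
apply/andP; split; apply/forallP=> x; first by rewrite ffunE; case: x => [[|[]]].
by apply/forallP=> y; rewrite !ffunE; case: x => [[|[]]] //; case: y => [[|[]]].
Qed.

Definition empty_graph (n : nat) : ograph n :=
  exist (fun e => oriented e) _ (empty_oriented n).

Definition edge_graph : ograph 2 :=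
  exist (fun e => oriented e) _ edge_oriented.

Definition type_empty : ftype := Tagged ograph (empty_graph 0).
Definition type_nonedge : ftype := Tagged ograph (empty_graph 2).
Definition type_edge : ftype := Tagged ograph edge_graph.

Definition is_rooting (s : ftype) (n : nat) (G : ograph n)
    (theta : {ffun 'I_(tag s) -> 'I_n}) : bool :=
  embedding (tagged s) G theta.

Record flag (s : ftype) := Flag {
  fsize : nat;
  fgraph : ograph fsize;
  froot : {ffun 'I_(tag s) -> 'I_fsize};
  frootP : is_rooting fgraph froot
}.

(* For A containing the image of the rooting theta of G: the flag induced on A
   by (G, theta) is isomorphic to F.  The isomorphism is given as an embedding
   of F in G with image A, rather than as a map to the subtype of A. *)
Definition induces (s : ftype) (n : nat) (G : ograph n)
    (theta : {ffun 'I_(tag s) -> 'I_n}) (A : {set 'I_n}) (F : flag s) : bool :=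
  [exists f : {ffun 'I_(fsize F) -> 'I_n},
    [&& embedding (fgraph F) G f,
        [set f x | x : 'I_(fsize F)] == A
      & [forall i, f (froot F i) == theta i]]].

Definition flag_iso (s : ftype) (F1 F2 : flag s) : bool :=
  induces (fgraph F2) (froot F2) [set: 'I_(fsize F2)] F1.

Definition tflag := {s : ftype & flag s}.

(* [tagged_as u v] is the flag of v, cast to the type of u when the types of u
   and v are equal. *)
Definition tflag_iso (F1 F2 : tflag) : bool :=
  (tag F1 == tag F2) && flag_iso (tagged F1) (tagged_as F1 F2).

Definition rootings (s : ftype) (n : nat) (G : ograph n) :=
  [set theta : {ffun 'I_(tag s) -> 'I_n} | is_rooting G theta].

Definition disjoint_pairs (n : nat) (S : {set 'I_n}) (l1 l2 : nat) :=
  [set L : {set 'I_n} * {set 'I_n} |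
    [&& L.1 \subset ~: S, L.2 \subset ~: S, [disjoint L.1 & L.2],
        #|L.1| == l1 & #|L.2| == l2]].

Definition pair_density_same (R : realType) (s : ftype) (F1 F2 : flag s)
    (n : nat) (G : ograph n) : R :=
  mean (rootings s G) (fun theta =>
    let S := [set theta i | i : 'I_(tag s)] in
    prob R (disjoint_pairs S (fsize F1 - tag s) (fsize F2 - tag s))
      (fun L => induces G theta (S :|: L.1) F1
             && induces G theta (S :|: L.2) F2)).

Definition pair_density (R : realType) (F1 F2 : tflag)
    (n : nat) (G : ograph n) : R :=
  if tag F1 == tag F2
  then pair_density_same R (tagged F1) (tagged_as F1 F2) G
  else 0.

Definition in_family (F : tflag) : bool :=
  (tag F, fsize (tagged F))
    \in [:: (type_empty, 2%N); (type_nonedge, 3%N); (type_edge, 3%N)].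

Definition complete_list (I X : Type) (P : pred X) (iso : rel X) (s : I -> X) :=
  [/\ forall i, P (s i),
      forall i j, iso (s i) (s j) -> i = j
    & forall x, P x -> exists i, iso x (s i)].

Definition flag_matrix (R : realType) (m : nat) (F : 'I_m -> tflag)
    (n : nat) (G : ograph n) : 'M[R]_m :=
  \matrix_(i, j) pair_density R (F i) (F j) G.

Definition inner (R : realType) (m : nat) (A B : 'M[R]_m) : R :=
  \sum_i \sum_j A i j * B i j.

Definition psd (R : realType) (m : nat) (Q : 'M[R]_m) : Prop :=
  Q^T = Q /\ forall v : 'cV[R]_m, 0 <= (v^T *m Q *m v) 0 0.

(* Main.v *)
(* Give each two-rooted three-vertex flag a weight depending only on how its
   third vertex is joined to the roots, and let Q be a nonnegative combination
   of squares of such weight vectors, with zero block for the empty type.  For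
   a rooting theta of a 4-vertex graph and disjoint L1, L2, exactly one flag of
   the list is induced on each of theta + L1 and theta + L2, so <Q, A_G>
   collapses to an average over theta and over the ordered pairs of the two
   other vertices of products of weights: an explicit function of G.  The
   inequality is then evaluated on all 3^6 labeled graphs.

   As p(F1, F2; G) is normalised by the number of rootings of G itself, and not
   by the number of all injections, the optimum of the semidefinite program is
   numerically 0.12 > 1/9; this slack permits a certificate with small integer
   weights. *)

Require Import Defs.
From Stdlib Require Import BinInt.
From mathcomp Require Import all_boot all_order all_algebra.
From mathcomp Require Import reals boolp.
From mathcomp Require Import zify ssrZ ring lra.

Set Implicit Arguments.
Unset Strict Implicit.
Unset Printing Implicit Defensive.

(* MathComp shadows [fgraph] and [froot]. *)
Import Defs.
Import Order.TTheory GRing.Theory Num.Theory.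
Local Open Scope ring_scope.

(** * Induced flags and their isomorphisms *)

Lemma embeddingP (k n : nat) (H : ograph k) (G : ograph n)
    (f : {ffun 'I_k -> 'I_n}) :
  reflect (injective f /\ forall x y, edge G (f x) (f y) = edge H x y)
          (embedding H G f).
Proof.
apply: (iffP andP) => [[/injectiveP injf /forallP fE]|[injf fE]]; split => //.
- by move=> x y; have /forallP/(_ y)/eqP := fE x.
- exact/injectiveP.
- by apply/forallP=> x; apply/forallP=> y; rewrite fE.
Qed.

Lemma inducesP (s : ftype) (n : nat) (G : ograph n)
    (theta : {ffun 'I_(tag s) -> 'I_n}) (A : {set 'I_n}) (F : flag s) :
  reflect (exists f : {ffun 'I_(fsize F) -> 'I_n},
             [/\ embedding (fgraph F) G f, f @: setT = A
               & forall i, f (froot F i) = theta i])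
          (induces G theta A F).
Proof.
have imT (f : {ffun 'I_(fsize F) -> 'I_n}) : [set f x | x : 'I_(fsize F)] = f @: setT.
  by apply/setP=> y; apply/imsetP/imsetP => -[x _ ->]; exists x.
apply: (iffP existsP) => [[f /and3P[fE /eqP <- /forallP fr]]|[f [fE <- fr]]].
  by exists f; split=> // i; apply/eqP.
exists f; rewrite fE imT eqxx /=; apply/forallP=> i; exact/eqP.
Qed.

(** The preimage comes as a sigma type, so that inverse maps can be defined as finite functions. *)
Lemma imset_sig (aT rT : finType) (f : aT -> rT) (A : {set aT}) (y : rT) :
  y \in f @: A -> {x | f x = y}.
Proof.
move=> yA; have [x /eqP] : {x | f x == y}; last by exists x.
by apply: sigW; have /imsetP[x _ ->] := yA; exists x.
Qed.

(** Both embeddings have image [A], so following the first by the inverse of the second is an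
    isomorphism. In a list of pairwise non-isomorphic flags, this gives uniqueness of the induced
    flag. *)
Lemma flag_iso_of_induces (s : ftype) (n : nat) (G : ograph n)
    (theta : {ffun 'I_(tag s) -> 'I_n}) (A : {set 'I_n}) (F1 F2 : flag s) :
  induces G theta A F1 -> induces G theta A F2 -> flag_iso F1 F2.
Proof.
move=> /inducesP[f1 [/embeddingP[inj1 e1] im1 r1]].
move=> /inducesP[f2 [/embeddingP[inj2 e2] im2 r2]].
have f2V x : {y | f2 y = f1 x}.
  by apply: (@imset_sig _ _ _ setT); rewrite im2 -im1 imset_f.
have f1V y : {x | f1 x = f2 y}.
  by apply: (@imset_sig _ _ _ setT); rewrite im1 -im2 imset_f.
pose m := [ffun x => sval (f2V x)].
have f2m x : f2 (m x) = f1 x by rewrite ffunE; case: (f2V x).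
apply/inducesP; exists m; split.
- apply/embeddingP; split=> [x y mxy|x y]; last by rewrite -e2 !f2m e1.
  by apply: inj1; rewrite -!f2m mxy.
- apply/setP=> y; rewrite inE; apply/imsetP; have [x fx] := f1V y.
  by exists x => //; apply: inj2; rewrite f2m.
- by move=> i; apply: inj2; rewrite f2m r1 r2.
Qed.

(** The embedding of [H] is precomposed with the inverse of the isomorphism from [H] to [F]. *)
Lemma induces_flag_iso (s : ftype) (n : nat) (G : ograph n)
    (theta : {ffun 'I_(tag s) -> 'I_n}) (A : {set 'I_n}) (H F : flag s) :
  induces G theta A H -> flag_iso H F -> induces G theta A F.
Proof.
move=> /inducesP[h [/embeddingP[injh eh] imh rh]].
move=> /inducesP[f [/embeddingP[injf ef] imf rf]].
have fV y : {x | f x = y}.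
  by apply: (@imset_sig _ _ _ setT); rewrite imf inE.
pose m := [ffun y => sval (fV y)].
have fm y : f (m y) = y by rewrite ffunE; case: (fV y).
have mf x : m (f x) = x by apply: injf; rewrite fm.
(* The body of [m] is forgotten so that [ffunE] below opens only the composite map. *)
clearbody m.
apply/inducesP; exists [ffun y => h (m y)]; split.
- apply/embeddingP; split=> [x y|x y]; rewrite !ffunE.
    by move/injh=> mxy; rewrite -(fm x) mxy fm.
  by rewrite eh -ef !fm.
- rewrite -imh; apply/setP=> z; apply/imsetP/imsetP => -[x _ ->].
    by exists (m x); rewrite ?ffunE.
  by exists (f x); rewrite ?ffunE ?mf.
- by move=> i; rewrite ffunE -rf mf rh.
Qed.

Lemma pullback_oriented (k n : nat) (G : ograph n) (h : 'I_k -> 'I_n) :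
  oriented [ffun p : 'I_k * 'I_k => edge G (h p.1) (h p.2)].
Proof.
have /andP[/forallP irr /forallP asym] := valP G.
apply/andP; split; apply/forallP=> x; first by rewrite ffunE irr.
by apply/forallP=> y; rewrite !ffunE; have /forallP/(_ (h y)) := asym (h x).
Qed.

Definition pullback (k n : nat) (G : ograph n) (h : 'I_k -> 'I_n) : ograph k :=
  exist (fun e => oriented e) _ (pullback_oriented G h).

Lemma edge_pullback (k n : nat) (G : ograph n) (h : 'I_k -> 'I_n) x y :
  edge (pullback G h) x y = edge G (h x) (h y).
Proof. by rewrite /edge ffunE. Qed.

(** The vertices of [A] are renumbered by [enum_val], and the edges and roots are pulled back along
    this numbering. *)
Lemma induced_flag_exists (s : ftype) (n : nat) (G : ograph n)
    (theta : {ffun 'I_(tag s) -> 'I_n}) (A : {set 'I_n}) :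
  is_rooting G theta -> (forall i, theta i \in A) ->
  exists2 H : flag s, fsize H = #|A| & induces G theta A H.
Proof.
move=> /embeddingP[injt et] tA.
pose h := [ffun i : 'I_#|A| => enum_val i].
pose root := [ffun i => enum_rank_in (tA i) (theta i)].
have hroot i : h (root i) = theta i by rewrite !ffunE enum_rankK_in.
have rootP : is_rooting (pullback G h) root.
  apply/embeddingP; split=> [i j rij|i j]; last by rewrite edge_pullback !hroot et.
  by apply: injt; rewrite -!hroot rij.
exists (Flag rootP) => //; apply/inducesP; exists h; split=> //.
- apply/embeddingP; split=> [i j|i j]; last by rewrite edge_pullback.
  by rewrite !ffunE; apply: enum_val_inj.
- apply/setP=> x; apply/imsetP/idP => [[i _ ->]|xA]; first by rewrite ffunE enum_valP.
  by exists (enum_rank_in xA x); rewrite // ffunE enum_rankK_in.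
Qed.

(** * Weights of flags *)

Definition adj (n : nat) (G : ograph n) (x y : 'I_n) : nat :=
  if edge G x y then 1 else if edge G y x then 2 else 0.

Definition profile (k n : nat) (G : ograph n) (theta : {ffun 'I_k -> 'I_n})
    (x : 'I_n) : seq nat :=
  [seq adj G (theta i) x | i <- enum 'I_k].

Lemma probE (R : realType) (T : finType) (A : {set T}) (P : pred T) :
  prob R A P = mean A (fun x => (P x)%:R).
Proof.
rewrite /prob /mean; congr (_ / _).
rewrite -sum1_card natr_sum big_mkcond [RHS]big_mkcond /=.
by apply: eq_bigr => x _; rewrite inE; case: (x \in A); case: (P x).
Qed.

Lemma eq_mean (R : realType) (T : finType) (A : {set T}) (f g : T -> R) :
  {in A, f =1 g} -> mean A f = mean A g.
Proof. by move=> fg; congr (_ / _); apply: eq_bigr. Qed.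

Lemma mean_sum (R : realType) (T I : finType) (A : {set T}) (f : I -> T -> R) :
  \sum_i mean A (f i) = mean A (fun x => \sum_i f i x).
Proof. by rewrite /mean -mulr_suml exchange_big. Qed.

Lemma mean0 (R : realType) (T : finType) (A : {set T}) :
  mean A (fun=> 0 : R) = 0.
Proof. by rewrite /mean big1 ?mul0r. Qed.

Lemma mean_mull (R : realType) (T : finType) (A : {set T}) (a : R) (f : T -> R) :
  a * mean A f = mean A (fun x => a * f x).
Proof. by rewrite /mean mulrA mulr_sumr. Qed.

Section Weights.
Variables (R : realType) (phi : seq nat -> R).

(** The certificate only meets singletons [L]; the sum avoids having to extract the element. *)
Definition weight (k n : nat) (G : ograph n) (theta : {ffun 'I_k -> 'I_n})
    (L : {set 'I_n}) : R :=
  \sum_(x in L) phi (profile G theta x).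

Definition flag_weight (s : ftype) (F : flag s) : R :=
  weight (fgraph F) (froot F) (~: [set froot F i | i : 'I_(tag s)]).

(** The embedding maps the unrooted vertices of [F] bijectively onto [L] and preserves edges and
    roots, hence profiles. The weight seen in [G] is thus an invariant of the induced flag. *)
Lemma induces_weight (s : ftype) (n : nat) (G : ograph n)
    (theta : {ffun 'I_(tag s) -> 'I_n}) (L : {set 'I_n}) (F : flag s)
    (S := [set theta i | i : 'I_(tag s)]) :
  L \subset ~: S -> induces G theta (S :|: L) F ->
  flag_weight F = weight G theta L.
Proof.
move=> LS /inducesP[f [/embeddingP[injf ef] imf rf]].
have -> : L = f @: (~: [set froot F i | i : 'I_(tag s)]).
  apply/setP=> y; apply/idP/imsetP => [yL|[x]].
    have : y \in f @: setT by rewrite imf inE yL orbT.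
    case/imsetP=> x _ yE; exists x => //; rewrite inE; apply/negP => /imsetP[i _ xE].
    by move/subsetP: LS => /(_ y yL); rewrite inE yE xE rf imset_f.
  rewrite inE => xr ->; have : f x \in S :|: L by rewrite -imf imset_f.
  rewrite inE => /orP[/imsetP[i _]|//]; rewrite -rf => /injf xE.
  by rewrite xE imset_f in xr.
rewrite /weight big_imset /=; last by move=> x y _ _; apply: injf.
apply: eq_bigr => x _; congr phi; apply: eq_map => i.
by rewrite /adj -rf !ef.
Qed.

(** The default 0 on flags of other types is what makes the certificate block diagonal. *)
Definition tflag_weight (s : ftype) (T : tflag) : R :=
  untag 0 (fun F : flag s => flag_weight F) T.

Definition induced_weight (s : ftype) (n : nat) (G : ograph n)
    (theta : {ffun 'I_(tag s) -> 'I_n}) (L : {set 'I_n}) (T : tflag) : R :=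
  untag 0 (fun F : flag s => flag_weight F *
    (induces G theta ([set theta i | i : 'I_(tag s)] :|: L) F)%:R) T.

Lemma untag_Tagged (s : ftype) (f : flag s -> R) (F : flag s) :
  untag 0 f (Tagged flag F) = f F.
Proof. by rewrite untagE //= => e; rewrite /etagged /= (eq_axiomK e). Qed.

Section Complete.
Variables (P : pred tflag) (N : nat) (F : 'I_N -> tflag).
Variables (s : ftype) (m : nat).
Hypothesis completeF : complete_list P tflag_iso F.
Hypothesis P_size : forall H : flag s, P (Tagged flag H) <-> fsize H = m.

(** Exactly one term survives: completeness of the list supplies a flag isomorphic to the induced
    one, and irredundancy excludes a second. *)
Lemma sum_induced_weight (n : nat) (G : ograph n)
    (theta : {ffun 'I_(tag s) -> 'I_n}) (L : {set 'I_n}) :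
  is_rooting G theta -> L \subset ~: [set theta i | i : 'I_(tag s)] ->
  (#|L| + tag s)%N = m ->
  \sum_i induced_weight G theta L (F i) = weight G theta L.
Proof.
set S := [set theta i | i : _] => Gtheta LS Lm.
have cardSL : #|S :|: L| = m.
  have /embeddingP[injt _] := Gtheta.
  rewrite cardsU (_ : S :&: L = set0); last first.
    by apply/eqP; rewrite setI_eq0 disjoint_sym disjoints_subset.
  by rewrite cards0 subn0 card_imset // card_ord addnC.
case: completeF => PF injF surjF.
have [i|H sizeH indH] := @induced_flag_exists s n G theta (S :|: L) Gtheta.
  by rewrite inE imset_f.
have [|i0 /andP[/eqP /= tF isoH]] := surjF (Tagged flag H).
  by apply/P_size; rewrite sizeH.
have [H0 FE indH0] : exists2 H0 : flag s, F i0 = Tagged flag H0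
                                        & induces G theta (S :|: L) H0.
  (* Destructing the equality of types turns the cast [tagged_as] into the identity. *)
  case: (F i0) tF isoH => s0 H0 /= e; case: s0 / e H0 => H0.
  by rewrite tagged_asE => isoH; exists H0; last exact: induces_flag_iso isoH.
rewrite (bigD1 i0) //= big1 ?addr0 => [|i ii0].
  by rewrite /induced_weight FE untag_Tagged indH0 mulr1 (induces_weight LS indH0).
case E : (F i) => [s1 H1]; have [e|ne] := eqVneq s s1; last first.
  by apply: untag_dflt; rewrite eq_sym.
case: s1 / e H1 E => H1 E; rewrite /induced_weight untag_Tagged.
case indH1 : (induces _ _ _ _); rewrite ?mulr0 //.
(* A second induced flag would be isomorphic to [H0], forcing equal indices. *)
case/eqP: ii0; apply: injF; rewrite E FE /tflag_iso eqxx tagged_asE.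
exact: flag_iso_of_induces indH1 indH0.
Qed.

(** Once the weights are moved inside the two means, the double sum over flags factors, for each
    rooting and each pair [L], into two sums given by [sum_induced_weight]. *)
Lemma sum_pair_density (n : nat) (G : ograph n) :
  (tag s <= m)%N ->
  \sum_i \sum_j tflag_weight s (F i) * tflag_weight s (F j)
                * pair_density R (F i) (F j) G
  = mean (rootings s G) (fun theta =>
      mean (disjoint_pairs [set theta i | i : 'I_(tag s)] (m - tag s) (m - tag s))
        (fun L => weight G theta L.1 * weight G theta L.2)).
Proof.
move=> sm; case: (completeF) => PF _ _.
pose DP theta := disjoint_pairs [set (theta : {ffun 'I_(tag s) -> 'I_n}) i | i : 'I_(tag s)]
                                (m - tag s) (m - tag s).
transitivity (\sum_i \sum_j mean (rootings s G) (fun theta => mean (DP theta)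
  (fun L => induced_weight G theta L.1 (F i) * induced_weight G theta L.2 (F j)))).
  apply: eq_bigr => i _; apply: eq_bigr => j _.
  move: (PF i) (PF j); case: (F i) => [s1 F1]; case: (F j) => [s2 F2].
  rewrite /induced_weight /tflag_weight.
  (* If a flag has another type, both sides vanish by the default of [untag]. *)
  have [e|ne] := eqVneq s s1; last first.
    rewrite untag_dflt 1?eq_sym // !mul0r => _ _; symmetry.
    under eq_mean do under eq_mean do rewrite untag_dflt 1?eq_sym // mul0r.
    by under eq_mean do rewrite mean0; rewrite mean0.
  case: s1 / e F1 => F1.
  have [e|ne] := eqVneq s s2; last first.
    rewrite [untag _ _ (Tagged _ F2)]untag_dflt 1?eq_sym // mulr0 mul0r => _ _; symmetry.
    under eq_mean do under eq_mean do rewrite [X in _ * X]untag_dflt 1?eq_sym // mulr0.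
    by under eq_mean do rewrite mean0; rewrite mean0.
  case: s2 / e F2 => F2 /P_size m1 /P_size m2.
  rewrite /pair_density eqxx tagged_asE /pair_density_same !untag_Tagged mean_mull.
  apply: eq_mean => theta _; rewrite m1 m2 probE mean_mull; apply: eq_mean => L _.
  by rewrite !untag_Tagged mulrACA -natrM mulnb.
under eq_bigr do rewrite mean_sum.
rewrite mean_sum; apply: eq_mean => theta; rewrite inE => Gtheta.
under eq_bigr do rewrite mean_sum.
rewrite mean_sum; apply: eq_mean => -[L1 L2].
rewrite inE => /and5P[/= L1S L2S _ /eqP L1m /eqP L2m].
rewrite -(sum_induced_weight Gtheta L1S) ?L1m ?subnK //.
rewrite -(sum_induced_weight Gtheta L2S) ?L2m ?subnK //.
by rewrite mulr_suml; apply: eq_bigr => i _; rewrite mulr_sumr.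
Qed.

End Complete.
End Weights.

(** * Two roots and four vertices *)

Section Edges.
Variables (n : nat) (G : ograph n).

Lemma edge_irr x : edge G x x = false.
Proof. by have /andP[/forallP/(_ x)/negbTE] := valP G. Qed.

Lemma edge_asym x y : edge G x y -> edge G y x = false.
Proof.
have /andP[_ /forallP/(_ x)/forallP/(_ y)/implyP asym] := valP G.
by move/asym/negbTE.
Qed.

Lemma adj_eq1 x y : (adj G x y == 1%N) = edge G x y.
Proof. by rewrite /adj; case: (edge G x y); case: (edge G y x). Qed.

Lemma adj_eq2 x y : (adj G x y == 2%N) = edge G y x.
Proof.
rewrite /adj; case xy : (edge G x y); first by rewrite (edge_asym xy).
by case: (edge G y x).
Qed.

Lemma adj_eq0 x y : (adj G x y == 0%N) = ~~ edge G x y && ~~ edge G y x.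
Proof. by rewrite /adj; case: (edge G x y); case: (edge G y x). Qed.

Lemma adjxx x : adj G x x = 0%N.
Proof. by rewrite /adj edge_irr. Qed.

Lemma adjC x y : adj G y x = nth 0%N [:: 0; 2; 1]%N (adj G x y).
Proof.
rewrite /adj; case xy : (edge G x y); first by rewrite (edge_asym xy).
by case: (edge G y x).
Qed.

Lemma adj_lt3 x y : (adj G x y < 3)%N.
Proof. by rewrite /adj; case: ifP => // _; case: ifP. Qed.

End Edges.

Lemma all_ord2 (P : 'I_2 -> Prop) : P ord0 -> P ord_max -> forall i, P i.
Proof. by move=> P0 P1 [[|[|//]] i]; [move: P0|move: P1]; congr P; apply: val_inj. Qed.

Definition pair_ffun (T : Type) (x y : T) : {ffun 'I_2 -> T} :=
  [ffun i => if i == ord0 then x else y].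

Lemma big_ffun2 (V : nmodType) (T : finType) (P : pred {ffun 'I_2 -> T})
    (E : {ffun 'I_2 -> T} -> V) :
  \sum_(theta | P theta) E theta
  = \sum_x \sum_(y | P (pair_ffun x y)) E (pair_ffun x y).
Proof.
rewrite pair_big_dep /=.
rewrite (reindex (fun p : T * T => pair_ffun p.1 p.2)) //=.
exists (fun theta : {ffun 'I_2 -> T} => (theta ord0, theta ord_max)) => [[x y] _|theta _] /=.
  by rewrite !ffunE.
by apply/ffunP; apply: all_ord2; rewrite ffunE.
Qed.

Section TwoRoots.
Variables (H : ograph 2) (n : nat) (G : ograph n).
Let s : ftype := Tagged ograph H.

(** The code [adj] records both directions between the roots, and loops are absent, so one equality
    of codes settles all four edge conditions. *)
Lemma is_rooting2 (x y : 'I_n) :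
  @is_rooting s n G (pair_ffun x y)
  = (x != y) && (adj G x y == adj H ord0 ord_max).
Proof.
apply/embeddingP/andP => [[inj e]|[xy /eqP e]].
  split.
    apply/eqP => xy; have /inj : pair_ffun x y ord0 = pair_ffun x y ord_max.
      by rewrite !ffunE.
    by move/(congr1 val).
  have := e ord0 ord_max; have := e ord_max ord0.
  by rewrite !ffunE /= /adj => -> ->.
have exy : edge G x y = edge H ord0 ord_max by rewrite -!adj_eq1 e.
have eyx : edge G y x = edge H ord_max ord0 by rewrite -!adj_eq2 e.
split.
  apply: all_ord2; apply: all_ord2; rewrite !ffunE //= => xyE; move: xy;
    by rewrite xyE eqxx.
by apply: all_ord2; apply: all_ord2; rewrite !ffunE //= !edge_irr.
Qed.

Lemma profile2 (x y z : 'I_n) :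
  profile G (pair_ffun x y) z = [:: adj G x z; adj G y z].
Proof. by rewrite /profile !enum_ordSl enum_ord0 /= !ffunE. Qed.

Lemma imset_pair_ffun (x y : 'I_n) :
  [set pair_ffun x y i | i : 'I_(tag s)] = [set x; y].
Proof.
apply/setP=> z; rewrite !inE; apply/imsetP/orP => [[i _ ->]|[]/eqP->].
- by rewrite ffunE; case: ifP => _; [left|right].
- by exists ord0; rewrite ?ffunE.
- by exists ord_max; rewrite ?ffunE.
Qed.

End TwoRoots.

Lemma disjoint_pairs11 (n : nat) (S : {set 'I_n}) :
  disjoint_pairs S 1 1
  = [set ([set p.1], [set p.2]) | p : 'I_n * 'I_n
       in [pred p | [&& p.1 \notin S, p.2 \notin S & p.1 != p.2]]].
Proof.
apply/setP=> -[L1 L2]; rewrite inE /=; apply/and5P/imsetP.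
- case=> L1S L2S L12 /cards1P[u L1u] /cards1P[v L2v].
  move: L1S L2S L12; rewrite L1u L2v !sub1set disjoints1 !inE => uS vS uv.
  by exists (u, v); rewrite // !inE /= uS vS uv.
- case=> -[u v]; rewrite !inE /= => /and3P[uS vS uv] [-> ->].
  by rewrite !sub1set disjoints1 !inE !cards1.
Qed.

Lemma big_disjoint_pairs11 (V : nmodType) (n : nat) (S : {set 'I_n})
    (E : {set 'I_n} * {set 'I_n} -> V) :
  \sum_(L in disjoint_pairs S 1 1) E L
  = \sum_(u | u \notin S) \sum_(v | (v \notin S) && (u != v)) E ([set u], [set v]).
Proof.
rewrite disjoint_pairs11 big_imset /=; last first.
  by move=> [u v] [u' v'] _ _ [/set1_inj -> /set1_inj ->].
rewrite pair_big_dep; apply: eq_bigl => -[u v]; by rewrite !inE.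
Qed.

(** Two vertices remain outside the roots, and they can be ordered in two ways. *)
Lemma card_disjoint_pairs11 (x y : 'I_4) :
  x != y -> #|disjoint_pairs [set x; y] 1 1| = 2%N.
Proof.
move=> xy; rewrite -sum1_card big_disjoint_pairs11.
have c2 : #|~: [set x; y]| = 2%N by have := cardsC [set x; y]; rewrite cards2 xy card_ord; lia.
rewrite (eq_bigl (fun u => u \in ~: [set x; y])) => [|u]; last by rewrite !inE.
rewrite (eq_bigr (fun=> 1%N)) ?sum1_card // => u uS.
rewrite sum1dep_card.
rewrite (_ : [set v | _] = (~: [set x; y]) :\ u); last first.
  by apply/setP=> v; rewrite !inE [u == v]eq_sym andbC.
by have := cardsD1 u (~: [set x; y]); rewrite uS c2 add1n => -[<-].
Qed.

(** The factor 2 counts the ordered pairs of unrooted vertices; the last denominator counts rootings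
    and may be 0, in which case both sides are 0. *)
Lemma mean_rootings2 (R : realType) (phi : seq nat -> R) (H : ograph 2) (G : ograph 4)
    (s := Tagged ograph H : ftype)
    (rooted := fun x y => (x != y) && (adj G x y == adj H ord0 ord_max)) :
  mean (rootings s G) (fun theta =>
      mean (disjoint_pairs [set theta i | i : 'I_(tag s)] 1 1)
        (fun L => weight phi G theta L.1 * weight phi G theta L.2))
  = (\sum_x \sum_(y | rooted x y)
       \sum_(u | u \notin [:: x; y]) \sum_(v | v \notin [:: x; y; u])
         phi [:: adj G x u; adj G y u] * phi [:: adj G x v; adj G y v])
    / 2 / (\sum_x \sum_(y | rooted x y) 1).
Proof.
rewrite {1}/mean.
rewrite -sum1_card natr_sum.
rewrite [X in X / _](eq_bigl (fun theta => is_rooting G theta)) => [|theta]; last by rewrite inE.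
rewrite [X in _ / X](eq_bigl (fun theta => is_rooting G theta)) => [|theta]; last by rewrite inE.
rewrite !big_ffun2; congr (_ / _); last first.
  by apply: eq_bigr => x _; apply: eq_bigl => y; rewrite is_rooting2.
rewrite mulr_suml; apply: eq_bigr => x _; rewrite mulr_suml.
apply: eq_big => [y|y]; rewrite is_rooting2 // => /andP[xy _].
rewrite imset_pair_ffun /mean card_disjoint_pairs11 //; congr (_ / _).
rewrite big_disjoint_pairs11; apply: eq_big => [u|u _]; first by rewrite !inE.
apply: eq_big => [v|v _].
  by rewrite !inE !negb_or -andbA [v == u]eq_sym.
by rewrite /weight !big_set1 !profile2.
Qed.

(** * Three-vertex sets in a four-vertex graph, indexed by the omitted vertex *)

Lemma three_sets4 : three_sets 4 = [set ~: [set w] | w : 'I_4].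
Proof.
apply/setP=> A; rewrite inE; apply/idP/imsetP => [/eqP A3|[w _ ->]].
  have /eqP/cards1P[w Aw] : #|~: A| = 1%N by have := cardsC A; rewrite A3 card_ord => -[].
  by exists w => //; rewrite -Aw setCK.
by have := cardsC [set w]; rewrite cards1 card_ord add1n => -[->].
Qed.

Lemma prob_three_sets4 (R : realType) (P : pred {set 'I_4}) :
  prob R (three_sets 4) P = (\sum_w (P (~: [set w]))%:R) / 4.
Proof.
have injC : injective (fun w : 'I_4 => ~: [set w]) by move=> u v /setC_inj/set1_inj.
rewrite probE /mean three_sets4 card_imset // card_ord big_imset //=.
by move=> u v _ _ /injC.
Qed.

(** The three edges force [x], [y], [z] to be distinct, so they fill the complement of [w] as soon
    as they avoid [w], by cardinality. *)
Lemma transitive_triangleC1 (G : ograph 4) (w : 'I_4) :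
  transitive_triangle G (~: [set w])
  = [exists x, exists y, exists z, [&& w \notin [:: x; y; z], adj G x y == 1%N,
                                       adj G y z == 1%N & adj G x z == 1%N]].
Proof.
apply: eq_existsb => x; apply: eq_existsb => y; apply: eq_existsb => z.
rewrite !adj_eq1; case xy: (edge G x y); last by rewrite !andbF.
case yz: (edge G y z); last by rewrite !andbF.
case xz: (edge G x z); last by rewrite !andbF.
rewrite !andbT.
have nxy : x != y by apply/eqP => e; rewrite e edge_irr in xy.
have nyz : y != z by apply/eqP => e; rewrite e edge_irr in yz.
have nxz : x != z by apply/eqP => e; rewrite e edge_irr in xz.
apply/eqP/idP => [e|].
  apply/negP=> wxyz; have : w \in [set x; y; z] by move: wxyz; rewrite !inE orbA.
  by rewrite -e !inE eqxx.
move=> wxyz; apply/esym/eqP; rewrite eqEcard; apply/andP; split.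
  apply/subsetP=> v vxyz; rewrite !inE; apply: contraNneq wxyz => <-.
  by move: vxyz; rewrite !inE orbA.
have := cardsC [set w]; rewrite cards1 card_ord add1n => -[->].
by rewrite -setUA cardsU1 cards2 !inE negb_or nxy nxz nyz.
Qed.

Lemma independentC1 (G : ograph 4) (w : 'I_4) :
  independent G (~: [set w])
  = [forall x, forall y, (w \notin [:: x; y]) ==> (adj G x y == 0%N)].
Proof.
apply/forall_inP/forallP => [ind x|ind x xw].
  apply/forallP => y; apply/implyP; rewrite !inE negb_or => /andP[wx wy].
  have xw : x \in ~: [set w] by rewrite !inE eq_sym.
  have yw : y \in ~: [set w] by rewrite !inE eq_sym.
  by rewrite adj_eq0 (forall_inP (ind x xw) y yw) (forall_inP (ind y yw) x xw).
apply/forall_inP => y yw; have /forallP/(_ y)/implyP := ind x.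
by rewrite adj_eq0 !inE negb_or !(eq_sym w) => /(_ _)/andP[]//; move: xw yw; rewrite !inE => -> ->.
Qed.

(** * Computation in binary integers and its transfer to the reals *)

Definition zR (R : realType) (z : Z) : R := (int_of_Z z)%:~R.

Section ZR.
Variable R : realType.
Local Notation zR := (@zR R).

Lemma zR0 : zR Z0 = 0.
Proof. by []. Qed.

Lemma zR1 : zR (Zpos 1) = 1.
Proof. by []. Qed.

Lemma zRD (x y : Z) : zR (x + y) = zR x + zR y.
Proof. by rewrite /zR !rmorphD. Qed.

Lemma zRB (x y : Z) : zR (x - y) = zR x - zR y.
Proof. by rewrite /zR !rmorphB. Qed.

Lemma zR_pos (p : positive) : zR (Zpos p) = (Pos.to_nat p)%:R.
Proof. by []. Qed.

Lemma zRM (x y : Z) : zR (x * y) = zR x * zR y.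
Proof. by rewrite /zR !rmorphM. Qed.

Lemma zR_sum (I : Type) (s : seq I) (P : pred I) (E : I -> Z) :
  zR (\sum_(i <- s | P i) E i) = \sum_(i <- s | P i) zR (E i).
Proof. exact: (big_morph zR zRD zR0). Qed.

Lemma zR_le (x y : Z) : Z.leb x y -> zR x <= zR y.
Proof. by rewrite /zR ler_int; lia. Qed.

Lemma zR_lt (x y : Z) : Z.ltb x y -> zR x < zR y.
Proof. by rewrite /zR ltr_int; lia. Qed.
End ZR.

Definition ords4 : seq 'I_4 :=
  [:: @Ordinal 4 0 isT; @Ordinal 4 1 isT; @Ordinal 4 2 isT; @Ordinal 4 3 isT].

Lemma mem_ords4 x : x \in ords4.
Proof. by case: x => [[|[|[|[|//]]]] i]; rewrite !inE -!val_eqE. Qed.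

(** A [foldr] over an explicit list reduces under [vm_compute], whereas the big operator is
    locked. *)
Definition zsum (P : pred 'I_4) (E : 'I_4 -> Z) : Z :=
  foldr (fun x a => if P x then Z.add (E x) a else a) Z0 ords4.

Lemma zsumE (P : pred 'I_4) (E : 'I_4 -> Z) : \sum_(x | P x) E x = zsum P E.
Proof.
rewrite (perm_big ords4) ?unlock //=.
by apply: uniq_perm; rewrite ?index_enum_uniq // => x; rewrite mem_index_enum mem_ords4.
Qed.

Lemma exists_ords4 (P : pred 'I_4) : [exists x, P x] = has P ords4.
Proof. by apply/existsP/hasP => [[x Px]|[x _ Px]]; exists x; rewrite ?mem_ords4. Qed.

Lemma forall_ords4 (P : pred 'I_4) : [forall x, P x] = all P ords4.
Proof. by apply/forallP/allP => Pall x => [_|]; apply: Pall; rewrite ?mem_ords4. Qed.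

(** * The certificate *)

Definition table_weight (t : seq Z) (p : seq nat) : Z :=
  nth Z0 t (3 * nth 0 p 0 + nth 0 p 1)%N.

Local Open Scope Z_scope.
(* The entry at 3 a + b of a table is the weight of a vertex x with codes
   a = adj G x1 x and b = adj G x2 x, for the two roots x1 and x2.  The tables
   and their multiplicities are rounded from a numerical solution of the
   semidefinite program; the multiplicities are over 5220. *)
Definition squares (b : bool) : seq (Z * seq Z) :=
  if b then
    [:: (10, [:: -8; -1; -2; -2; 16; 7; -1; 10; 16]);
        (51, [:: 0; 4; 6; -6; 0; 0; -4; 0; 0])]
  else
    [:: (32, [:: 12; 1; 1; 1; -3; -2; 1; -2; -3]);
        (103, [:: 0; 7; 0; 0; 3; 0; -7; 0; -3])].
Local Close Scope Z_scope.

(** * The exhaustive check over labeled graphs *)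

Local Open Scope nat_scope.
Definition graph_of_codes (c : seq nat) (x y : 'I_4) : nat :=
  let c01 := nth 0 c 0 in let c02 := nth 0 c 1 in let c03 := nth 0 c 2 in
  let c12 := nth 0 c 3 in let c13 := nth 0 c 4 in let c23 := nth 0 c 5 in
  let op := nth 0 [:: 0; 2; 1] in
  nth 0 (nth [::] [:: [:: 0; c01; c02; c03];
                      [:: op c01; 0; c12; c13];
                      [:: op c02; op c12; 0; c23];
                      [:: op c03; op c13; op c23; 0]] x) y.

Local Close Scope nat_scope.

Section Counts.
Variable r : 'I_4 -> 'I_4 -> nat.

(** The boolean is read as a code: 0 for the non-edge type, 1 for the edge type. *)
Definition rooted (b : bool) (x y : 'I_4) : bool := (x != y) && (r x y == b).

Definition num_rootings (b : bool) : Z :=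
  zsum xpredT (fun x => zsum (rooted b x) (fun=> Zpos 1)).

Definition square_sum (b : bool) (t : seq Z) : Z :=
  zsum xpredT (fun x => zsum (rooted b x) (fun y =>
    zsum (fun u => u \notin [:: x; y]) (fun u =>
      zsum (fun v => v \notin [:: x; y; u]) (fun v =>
        Z.mul (table_weight t [:: r x u; r y u]) (table_weight t [:: r x v; r y v]))))).

Definition total_square_sum (b : bool) : Z :=
  foldr (fun q a => Z.add (Z.mul q.1 (square_sum b q.2)) a) Z0 (squares b).

Definition transitive_avoiding (w : 'I_4) : bool :=
  has (fun x => has (fun y => has (fun z =>
    [&& w \notin [:: x; y; z], r x y == 1%N, r y z == 1%N & r x z == 1%N])
    ords4) ords4) ords4.

Definition independent_avoiding (w : 'I_4) : bool :=
  all (fun x => all (fun y => (w \notin [:: x; y]) ==> (r x y == 0%N)) ords4) ords4.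

Definition num_good_triples : Z :=
  Z.add (zsum transitive_avoiding (fun=> Zpos 1))
        (zsum independent_avoiding (fun=> Zpos 1)).
End Counts.

Section Check.
Local Open Scope Z_scope.

(* [x0 / n0 + x1 / n1 <= 2 * 5220 * (T / 4 - 1 / 9)] with denominators cleared,
   where [T] counts the good triples and the 2 is the number of ordered pairs of
   unrooted vertices; a quotient with [n = 0] has the junk value [0]. *)
Definition certified (r : 'I_4 -> 'I_4 -> nat) : bool :=
  let n0 := num_rootings r false in
  let n1 := num_rootings r true in
  let x0 := total_square_sum r false in
  let x1 := total_square_sum r true in
  let m0 := Z.max 1 n0 in
  let m1 := Z.max 1 n1 in
  [&& (0 <=? n0), (0 <=? n1), (n0 =? 0) ==> (x0 =? 0), (n1 =? 0) ==> (x1 =? 0) &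
      (Z.add (Z.mul x0 m1) (Z.mul x1 m0)
       <=? Z.mul (Z.mul (Z.mul 2 m0) m1)
             (Z.sub (Z.mul 1305 (num_good_triples r)) 580))].
End Check.

Lemma all_certified :
  all (fun a => all (fun b => all (fun c => all (fun d => all (fun e => all (fun f =>
    certified (graph_of_codes [:: a; b; c; d; e; f]))
  (iota 0 3)) (iota 0 3)) (iota 0 3)) (iota 0 3)) (iota 0 3)) (iota 0 3).
Proof. by vm_compute. Qed.

Lemma adj_graph_of_codes (G : ograph 4) :
  exists2 c : 6.-tuple nat, all (fun a => a \in iota 0 3) c & adj G = graph_of_codes c.
Proof.
pose i0 := @Ordinal 4 0 isT; pose i1 := @Ordinal 4 1 isT.
pose i2 := @Ordinal 4 2 isT; pose i3 := @Ordinal 4 3 isT.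
exists [tuple adj G i0 i1; adj G i0 i2; adj G i0 i3; adj G i1 i2; adj G i1 i3; adj G i2 i3].
  by apply/allP => a; rewrite mem_iota !inE;
    do ![case/predU1P=> [->|] | move/eqP->]; rewrite adj_lt3.
(* Extensionality gives an equality of functions, which can be rewritten inside [certified]. *)
apply/funext => x; apply/funext => y.
have := mem_ords4 x; have := mem_ords4 y; rewrite !inE => /or4P ys /or4P xs.
by case: xs => /eqP->; case: ys => /eqP->; rewrite /graph_of_codes /= ?adjxx // adjC.
Qed.

Lemma adj_certified (G : ograph 4) : certified (adj G).
Proof.
have [c + ->] := adj_graph_of_codes G.
case/tupleP: c => c1 c; case/tupleP: c => c2 c; case/tupleP: c => c3 c.
case/tupleP: c => c4 c; case/tupleP: c => c5 c; case/tupleP: c => c6 c.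
rewrite (tuple0 c) => /andP[m1 /andP[m2 /andP[m3 /andP[m4 /andP[m5 /andP[m6 _]]]]]].
exact: (allP (allP (allP (allP (allP (allP all_certified _ m1) _ m2) _ m3) _ m4) _ m5) _ m6).
Qed.

Lemma t_plus_i_density (R : realType) (G : ograph 4) :
  t_density R G + i_density R G = zR R (num_good_triples (adj G)) / 4.
Proof.
rewrite /t_density /i_density !prob_three_sets4 -mulrDl; congr (_ / _).
rewrite zRD -!zsumE !zR_sum [in RHS]big_mkcond [X in _ = _ + X]big_mkcond.
congr (_ + _); apply: eq_bigr => w _.
  rewrite transitive_triangleC1 (_ : [exists x, _] = transitive_avoiding (adj G) w).
    by case: transitive_avoiding.
  rewrite exists_ords4; apply: eq_has => x.
  by rewrite exists_ords4; apply: eq_has => y; rewrite exists_ords4.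
rewrite independentC1 (_ : [forall x, _] = independent_avoiding (adj G) w).
  by case: independent_avoiding.
by rewrite forall_ords4; apply: eq_all => x; rewrite forall_ords4.
Qed.

Definition two_graph (b : bool) : ograph 2 := if b then edge_graph else empty_graph 2.
Definition two_type (b : bool) : ftype := Tagged ograph (two_graph b).

Lemma adj_two_graph b : adj (two_graph b) ord0 ord_max = b.
Proof. by case: b; rewrite /adj /edge /= !ffunE. Qed.

Lemma in_family_two_type b (H : flag (two_type b)) :
  in_family (Tagged flag H) <-> fsize H = 3%N.
Proof.
have neq : type_nonedge == type_edge = false.
  (* Both types have two labels; only the code between the labels tells them apart. *)
  apply/negP; rewrite -tag_eqE /tag_eq /= tagged_asE => /eqP e.
  have : adj (two_graph false) ord0 ord_max = adj (two_graph true) ord0 ord_max.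
    by congr (adj _ _ _).
  by rewrite !adj_two_graph.
rewrite /in_family !inE !xpair_eqE /=; case: b H => H; rewrite /two_type /=.
  by rewrite [_ == type_nonedge]eq_sym neq eqxx /=; split=> [/eqP|->].
by rewrite neq eqxx orbF /=; split=> [/eqP|->].
Qed.

Definition square_weight (R : realType) (b : bool) (t : seq Z) (T : tflag) : R :=
  tflag_weight (fun p => zR R (table_weight t p)) (two_type b) T.

(** This links the quadratic form in the flag densities to the integers evaluated by the check. *)
Lemma sum_square_weight (R : realType) (N : nat) (F : 'I_N -> tflag) (b : bool)
    (t : seq Z) (G : ograph 4) :
  complete_list in_family tflag_iso F ->
  \sum_i \sum_j square_weight R b t (F i) * square_weight R b t (F j)
                * pair_density R (F i) (F j) G
  = zR R (square_sum (adj G) b t) / 2 / zR R (num_rootings (adj G) b).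
Proof.
move=> completeF.
rewrite (sum_pair_density _ completeF (@in_family_two_type b)) //.
rewrite mean_rootings2 /square_sum /num_rootings -!zsumE !zR_sum /= adj_two_graph.
congr (_ / _ / _); apply: eq_bigr => x _; rewrite -zsumE zR_sum /=; last first.
  by apply: eq_bigr => y _; rewrite zR1.
apply: eq_bigr => y _; rewrite -zsumE zR_sum /=.
apply: eq_bigr => u _; rewrite -zsumE zR_sum /=.
by apply: eq_bigr => v _; rewrite -zRM.
Qed.

Definition certificate (R : realType) (m : nat) (F : 'I_m -> tflag) : 'M[R]_m :=
  \sum_b \sum_(q <- squares b)
    (zR R q.1 / 5220) *: ((\col_i square_weight R b q.2 (F i))
                          *m (\col_i square_weight R b q.2 (F i))^T).

(** * Positive semidefiniteness and the inner product *)

Lemma psd0 (R : realType) (m : nat) : psd (0 : 'M[R]_m).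
Proof. by split=> [|v]; rewrite ?trmx0 // mulmx0 mul0mx mxE. Qed.

Lemma psdD (R : realType) (m : nat) (A B : 'M[R]_m) : psd A -> psd B -> psd (A + B).
Proof.
move=> [AT Apos] [BT Bpos]; split=> [|v]; first by rewrite linearD /= AT BT.
by rewrite mulmxDr mulmxDl mxE addr_ge0.
Qed.

(** The quadratic form at [v] is [a] times the square of the scalar [w^T *m v]. *)
Lemma psd_square (R : realType) (m : nat) (a : R) (w : 'cV[R]_m) :
  0 <= a -> psd (a *: (w *m w^T)).
Proof.
move=> a0; split=> [|v]; first by rewrite linearZ /= trmx_mul trmxK.
have -> : v^T *m (a *: (w *m w^T)) *m v = a *: ((w^T *m v)^T *m (w^T *m v)).
  by rewrite -scalemxAr -scalemxAl trmx_mul trmxK !mulmxA.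
by rewrite !mxE big_ord1 mxE mulr_ge0 // -expr2 sqr_ge0.
Qed.

Lemma certificate_psd (R : realType) (m : nat) (F : 'I_m -> tflag) :
  psd (certificate R F).
Proof.
apply: (big_ind (@psd R m)) => [||b _]; [exact: psd0|exact: psdD|].
(* Membership in [squares b] is kept, so that the signs of the multiplicities can be read off. *)
rewrite big_seq; apply: (big_ind (@psd R m)) => [||q qb]; [exact: psd0|exact: psdD|].
apply/psd_square/divr_ge0 => //; rewrite -(zR0 R); apply: zR_le.
by case: b qb; rewrite !inE => /orP[]/eqP->.
Qed.

(** By linearity each square contributes its own quadratic form; 10440 is the scale 5220 times the 2
    of the ordered pairs. *)
Lemma inner_certificate (R : realType) (N : nat) (F : 'I_N -> tflag) (G : ograph 4) :
  complete_list in_family tflag_iso F ->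
  inner (certificate R F) (flag_matrix R F G)
  = (\sum_b zR R (total_square_sum (adj G) b) / zR R (num_rootings (adj G) b)) / 10440.
Proof.
move=> completeF; rewrite /inner.
transitivity (\sum_b \sum_(q <- squares b) zR R q.1 / 5220 *
    (\sum_i \sum_j square_weight R b q.2 (F i) * square_weight R b q.2 (F j)
                   * pair_density R (F i) (F j) G)).
  under eq_bigr => i _ do under eq_bigr => j _ do
    rewrite /certificate summxE mulr_suml.
  under eq_bigr do rewrite exchange_big.
  rewrite exchange_big; apply: eq_bigr => b _ /=.
  under eq_bigr => i _ do under eq_bigr => j _ do rewrite summxE mulr_suml.
  under eq_bigr do rewrite exchange_big.
  rewrite exchange_big; apply: eq_bigr => q _ /=; rewrite mulr_sumr.
  apply: eq_bigr => i _; rewrite mulr_sumr; apply: eq_bigr => j _.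
  by rewrite !mxE big_ord1 !mxE !mulrA.
rewrite mulr_suml; apply: eq_bigr => b _.
have -> : total_square_sum (adj G) b
          = \sum_(q <- squares b) q.1 * square_sum (adj G) b q.2 by rewrite unlock.
rewrite zR_sum /= !mulr_suml; apply: eq_bigr => q _.
rewrite (sum_square_weight _ _ _ _ completeF) zRM.
have -> : 10440 = 5220 * 2 :> R by rewrite -natrM.
by rewrite invfM; ring.
Qed.

Theorem theorem5p1 (R : realType)
    (G : 'I_42 -> ograph 4) (F : 'I_20 -> tflag)
    (hG : complete_list xpredT (@ograph_iso 4) G)
    (hF : complete_list in_family tflag_iso F) :
  exists2 Q : 'M[R]_20, psd Q &
    forall i : 'I_42,
      t_density R (G i) + i_density R (G i)
        >= inner Q (flag_matrix R F (G i)) + 1 / 9%:R.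
Proof.
exists (certificate R F) => [|i]; first exact: certificate_psd.
rewrite inner_certificate // t_plus_i_density big_bool /=.
case/and5P: (adj_certified (G i)).
set n0 := num_rootings _ false; set n1 := num_rootings _ true.
set x0 := total_square_sum _ false; set x1 := total_square_sum _ true.
set T := num_good_triples _ => n0_ge0 n1_ge0 x0_eq0 x1_eq0 le.
(* Replacing [n] by its maximum with 1 makes denominators positive without changing quotients: when
   [n] is 0, so is [x]. *)
have ratioE n x : Z.leb Z0 n -> (Z.eqb n Z0 ==> Z.eqb x Z0) ->
    zR R x / zR R n = zR R x / zR R (Z.max (Zpos 1) n) /\ 0 < zR R (Z.max (Zpos 1) n).
  move=> n_ge0 nx; split; last first.
    by rewrite -(zR0 R); apply: zR_lt; lia.
  case: (n =P Z0) nx => [-> /Z.eqb_eq ->|nn _]; first by rewrite zR0 !mul0r.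
  by congr (_ / zR R _); lia.
have [-> m0_gt0] := ratioE _ _ n0_ge0 x0_eq0.
have [-> m1_gt0] := ratioE _ _ n1_ge0 x1_eq0.
move: le m0_gt0 m1_gt0; set m0 := Z.max (Zpos 1) n0; set m1 := Z.max (Zpos 1) n1.
(* The operations of [Z] are restated as ring operations, so that [zRD], [zRM] and [zRB] match. *)
move=> /(zR_le R); rewrite -[Z.add _ _]/(x0 * m1 + x1 * m0).
rewrite -[Z.mul _ _]/(Zpos 2 * m0 * m1 * (Zpos 1305 * T - Zpos 580)).
rewrite [zR R (_ + _)]zRD !(zRM, zRB) !zR_pos.
rewrite (_ : Pos.to_nat 2 = 2%N) // (_ : Pos.to_nat 1305 = 1305%N) //.
rewrite (_ : Pos.to_nat 580 = 580%N) //.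
set X0 := zR R x0; set X1 := zR R x1; set M0 := zR R m0; set M1 := zR R m1.
move: (zR R T) X0 X1 M0 M1 => t X0 X1 M0 M1 le M0_gt0 M1_gt0.
have {le} : X1 / M1 + X0 / M0 <= 2610 * t - 1160.
  rewrite -(ler_pM2r (mulr_gt0 M0_gt0 M1_gt0)).
  have -> : (X1 / M1 + X0 / M0) * (M0 * M1) = X0 * M1 + X1 * M0.
    by field; rewrite !gt_eqF.
  suff -> : (2610 * t - 1160) * (M0 * M1) = 2 * M0 * M1 * (1305 * t - 580) by [].
  by ring.
(* Dividing by 10440 turns 2610 into 1/4 and 1160 into 1/9. *)
by move: (X1 / M1 + X0 / M0) => S; lra.
Qed.
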